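(* Let $G=(V,E,w)$ be a weighted graph, $k\ge 1$, and $f$ a positive integer. Let $H$ be the output of the Light Fault-Tolerant Greedy Spanner Algorithm on input $(G,k,f)$. Then $H$ is an $f$-EFT $k$-spanner of $G$.
   Context: An edge-subgraph $H$ of $G$ is an $f$-EFT $k$-spanner of $G$ if $\mathrm{dist}_{H\setminus F}(u,v)\le k\cdot \mathrm{dist}_{G\setminus F}(u,v)$ for all $u,v\in V$ and all $F\subseteq E$ with $|F|\le f$. A subgraph $Q\subseteq G$ is an $f'$-EFT connectivity preserver if for every $F\subseteq E$ with $|F|\le f'$, the connected components of $Q\setminus F$ equal those of $G\setminus F$. Light Fault-Tolerant Greedy Spanner Algorithm on input $(G,k,f)$: let $Q$ be a minimum-weight $2f$-EFT connectivity preserver of $G$; initialize $H\leftarrow Q$; then for each edge $(u,v)\in E(G)\setminus Q$ in order of nondecreasing weight, add $(u,v)$ to $H$ if and only if there exists $F\subseteq E(H)$ with $|F|\le f$ such that $\mathrm{dist}_{H\setminus F}(u,v)>k\cdot w(u,v)$ (with $H$ the current graph); return $H$. *)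

(* Defs.v *)
From HB Require Import structures.
From mathcomp Require Import all_boot all_order all_algebra.
From mathcomp Require Import boolp classical_sets reals ereal.

Set Implicit Arguments.
Unset Strict Implicit.
Unset Printing Implicit Defensive.

Import Order.TTheory GRing.Theory Num.Theory.

Local Open Scope ring_scope.

(* Finite simple undirected graph: an edge is a two-element set of vertices.
   The values of [weight] off [edges] are irrelevant. *)
Record wgraph (R : realType) (V : finType) := WGraph {
  edges : {set {set V}};
  weight : {set V} -> R;
  edges_card2 : forall e, e \in edges -> #|e| = 2%N;
  weight_ge0 : forall e, e \in edges -> 0 <= weight e }.

(* The edge-subgraphs of G (all of them on the full vertex set V) are
   represented by the subsets of [edges G]; in particular the graph D \ F is
   the set D :\: F. *)
Section Subgraphs.
Variables (R : realType) (V : finType).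
Implicit Types (G : wgraph R V) (D F H Q : {set {set V}}) (u v : V).

Definition adj D : rel V := fun x y => [set x; y]%SET \in D.

Definition components D : {set {set V}} :=
  equivalence_partition (connect (adj D)) [set: V]%SET.

Definition path_length G u (p : seq V) : R :=
  \sum_(e <- pairmap (fun x y => [set x; y]%SET) u p) weight G e.

(* Equal to +oo when D has no path from u to v. Repeated vertices are allowed
   in p; for weights >= 0 they do not change the infimum. *)
Definition dist G D u v : \bar R :=
  ereal_inf [set (path_length G u p)%:E | p in
    [set p : seq V | path (adj D) u p /\ last u p = v]]%classic.

Definition eft_spanner G (k : R) (f : nat) H : Prop :=
  H \subset edges G /\
  forall u v F, F \subset edges G -> (#|F| <= f)%N ->
    (dist G (H :\: F) u v <= k%:E * dist G (edges G :\: F) u v)%E.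

Definition eft_connectivity_preserver G (f : nat) Q : Prop :=
  Q \subset edges G /\
  forall F, F \subset edges G -> (#|F| <= f)%N ->
    components (Q :\: F) = components (edges G :\: F).

Definition total_weight G D : R := \sum_(e in D) weight G e.

Definition min_weight_eft_connectivity_preserver G (f : nat) Q : Prop :=
  eft_connectivity_preserver G f Q /\
  forall Q', eft_connectivity_preserver G f Q' ->
    total_weight G Q <= total_weight G Q'.

(* An edge e determines its endpoints u, v only up to order, which is
   immaterial since [dist] is symmetric. *)
Definition greedy_test G (k : R) (f : nat) H (e : {set V}) : bool :=
  [exists F : {set {set V}}, [&& F \subset H, (#|F| <= f)%N &
    [exists u, exists v, (e == [set u; v]%SET) &&
      ((k * weight G e)%:E < dist G (H :\: F) u v)%E]]].

Definition greedy_step G (k : R) (f : nat) H (e : {set V}) : {set {set V}} :=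
  if greedy_test G k f H e then (e |: H)%SET else H.

(* The algorithm leaves open the choice of Q and the order among edges of equal
   weight, hence "H is an output" is a relation. *)
Definition light_ft_greedy_output G (k : R) (f : nat) H : Prop :=
  exists Q (s : seq {set V}),
    [/\ min_weight_eft_connectivity_preserver G (2 * f)%N Q,
        perm_eq s (enum (edges G :\: Q)),
        sorted (fun e1 e2 => weight G e1 <= weight G e2) s
      & H = foldl (greedy_step G k f) Q s].

End Subgraphs.

(* Main.v *)
Require Import Defs.
From mathcomp Require Import reals ereal.
From mathcomp Require Import all_boot all_order all_algebra.

Set Implicit Arguments.
Unset Strict Implicit.
Unset Printing Implicit Defensive.

Import Order.TTheory GRing.Theory Num.Theory.

Local Open Scope ring_scope.

(** Since a shortest path can be replaced edge by edge, [H] is an [f]-EFT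
    [k]-spanner as soon as, for every edge [e] of [G] and every set [F] of at
    most [f] faults avoiding [e], the endpoints of [e] are at distance at most
    [k * w e] in [H \ F]. This condition on [e] is preserved when [H] grows, so
    it is enough that it holds right after [e] has been processed. If [e] has
    been kept, [e] itself is a path of stretch [1 <= k]; if [e] has been
    rejected, the condition is the failure of the test on [F :&: H]. *)

Section Distance.
Variables (R : realType) (V : finType) (G : wgraph R V).
Implicit Types (D : {set {set V}}) (u v x y : V) (p q : seq V).

Lemma path_length_nil u : path_length G u [::] = 0.
Proof. exact: big_nil. Qed.

Lemma path_length_cons u v p :
  path_length G u (v :: p) = weight G [set u; v] + path_length G v p.
Proof. by rewrite /path_length /= big_cons. Qed.

Lemma path_length_cat u p q :
  path_length G u (p ++ q) = path_length G u p + path_length G (last u p) q.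
Proof. by rewrite /path_length pairmap_cat big_cat. Qed.

Lemma path_length_ge0 D u p :
  D \subset edges G -> path (adj D) u p -> 0 <= path_length G u p.
Proof.
move=> /subsetP sDG; elim: p u => [|v p IHp] u /=.
  by rewrite path_length_nil.
case/andP=> /sDG/weight_ge0 w_ge0 /IHp; rewrite path_length_cons.
exact: addr_ge0.
Qed.

Lemma dist_le_path_length D u p :
  path (adj D) u p -> (dist G D u (last u p) <= (path_length G u p)%:E)%E.
Proof. by move=> Dp; apply: ereal_inf_lbound; exists p. Qed.

Lemma dist_ge0 D u v : D \subset edges G -> (0 <= dist G D u v)%E.
Proof.
move=> sDG; apply/ereal_infP => _ [p [Dp _] <-].
by rewrite lee_fin (path_length_ge0 sDG).
Qed.

Lemma distxx_le0 D u : (dist G D u u <= 0)%E.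
Proof.
by have := @dist_le_path_length D u [::] isT; rewrite path_length_nil.
Qed.

Lemma dist_le_weight D x y :
  adj D x y -> (dist G D x y <= (weight G [set x; y])%:E)%E.
Proof.
move=> Dxy; have /= := @dist_le_path_length D x [:: y].
by rewrite Dxy path_length_cons path_length_nil addr0; apply.
Qed.

Lemma dist_subset_le D D' u v :
  D \subset D' -> (dist G D' u v <= dist G D u v)%E.
Proof.
move=> /subsetP sDD'; apply: ereal_inf_le_tmp => _ [p [Dp pv] <-].
by exists p => //; split=> //; apply: sub_path Dp => x y /sDD'.
Qed.

Lemma dist_triangle D u v x :
  D \subset edges G -> (dist G D u x <= dist G D u v + dist G D v x)%E.
Proof.
move=> sDG; have [uv_fin|] := boolP (dist G D u v \is a fin_num); last first.
  rewrite ge0_fin_numE ?dist_ge0 // -leNgt leye_eq => /eqP ->.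
  by rewrite addye ?leey // gt_eqF // (lt_le_trans _ (dist_ge0 v x sDG)).
rewrite -leeBlDl //; apply/ereal_infP => _ [q [Dq qx] <-].
rewrite leeBlDl // -leeBlDr //; apply/ereal_infP => _ [p [Dp pv] <-].
rewrite leeBlDr // -EFinD -qx -pv -last_cat -path_length_cat.
by apply: dist_le_path_length; rewrite cat_path Dp pv.
Qed.

End Distance.

Section EdgeStretch.
Variables (R : realType) (V : finType) (G : wgraph R V) (k : R).
Implicit Types (D H F : {set {set V}}) (u v : V) (e : {set V}) (f : nat).

Definition spans_edge D e : Prop :=
  forall u v, e = [set u; v] -> (dist G D u v <= (k * weight G e)%:E)%E.

Definition eft_spans_edge f H e : Prop :=
  forall F, (#|F| <= f)%N -> e \notin F -> spans_edge (H :\: F) e.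

Lemma spans_edge_subset D D' e :
  D \subset D' -> spans_edge D e -> spans_edge D' e.
Proof. by move=> sDD' De u v /De; apply/le_trans/dist_subset_le. Qed.

Lemma mem_spans_edge D e :
  1 <= k -> 0 <= weight G e -> e \in D -> spans_edge D e.
Proof.
move=> k_ge1 w_ge0 De u v e_uv; have Duv : adj D u v by rewrite /adj -e_uv.
by apply: le_trans (dist_le_weight G Duv) _; rewrite -e_uv lee_fin ler_peMl.
Qed.

Lemma dist_le_spans_edge D D' u v :
    0 < k -> D' \subset edges G -> (forall e, e \in D -> spans_edge D' e) ->
  (dist G D' u v <= k%:E * dist G D u v)%E.
Proof.
move=> k_gt0 sD'G D'D; rewrite -lee_pdivrMl //.
apply/ereal_infP => _ [p [Dp <-] <-]; rewrite lee_pdivrMl // -EFinM.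
elim: p u Dp => [|x p IHp] u /=.
  by rewrite path_length_nil mulr0 distxx_le0.
case/andP=> Dux Dp; apply: le_trans (dist_triangle u x _ sD'G) _.
by rewrite path_length_cons mulrDr EFinD leeD ?IHp //; apply: D'D.
Qed.

Lemma eft_spans_edge_subset f H H' e :
  H \subset H' -> eft_spans_edge f H e -> eft_spans_edge f H' e.
Proof.
move=> sHH' He F le_Ff notFe.
exact: spans_edge_subset (setSD F sHH') (He F le_Ff notFe).
Qed.

Lemma mem_eft_spans_edge f H e :
  1 <= k -> 0 <= weight G e -> e \in H -> eft_spans_edge f H e.
Proof.
by move=> k_ge1 w_ge0 He F _ notFe; apply: mem_spans_edge; rewrite // inE notFe.
Qed.

Lemma eft_spanner_spans_edge f H :
    0 < k -> H \subset edges G ->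
    (forall e, e \in edges G -> eft_spans_edge f H e) ->
  eft_spanner G k f H.
Proof.
move=> k_gt0 sHG HG; split=> // u v F _ le_Ff.
apply: dist_le_spans_edge => // [|e].
  exact: subset_trans (subsetDl H F) sHG.
by rewrite inE => /andP[notFe Ge]; apply: HG.
Qed.

End EdgeStretch.

Section Greedy.
Variables (R : realType) (V : finType) (G : wgraph R V) (k : R) (f : nat).
Implicit Types (D H Q : {set {set V}}) (e : {set V}) (s : seq {set V}).

Definition greedy Q s : {set {set V}} := foldl (greedy_step G k f) Q s.

Lemma greedy_testN_eft_spans_edge H e :
  ~~ greedy_test G k f H e -> eft_spans_edge G k f H e.
Proof.
move=> rejected F le_Ff _ u v e_uv; rewrite leNgt.
apply: contra rejected => far.
apply/existsP; exists (H :&: F); rewrite subsetIl /=.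
rewrite (leq_trans (subset_leq_card (subsetIr H F)) le_Ff) /=.
apply/existsP; exists u; apply/existsP; exists v.
by rewrite e_uv eqxx -e_uv setDIr setDv set0U.
Qed.

Lemma subset_greedy_step H e : H \subset greedy_step G k f H e.
Proof. by rewrite /greedy_step; case: ifP => // _; apply: subsetUr. Qed.

Lemma greedy_step_eft_spans_edge H e :
  1 <= k -> 0 <= weight G e -> eft_spans_edge G k f (greedy_step G k f H e) e.
Proof.
move=> k_ge1 w_ge0; rewrite /greedy_step; case: ifPn => [_|].
  exact: mem_eft_spans_edge (setU11 e H).
exact: greedy_testN_eft_spans_edge.
Qed.

Lemma subset_greedy Q s : Q \subset greedy Q s.
Proof.
elim: s Q => [|e s IHs] Q //=.
exact: subset_trans (subset_greedy_step Q e) (IHs _).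
Qed.

Lemma greedy_subset D Q s :
  Q \subset D -> {subset s <= D} -> greedy Q s \subset D.
Proof.
elim: s Q => [|e s IHs] Q //= sQD sD; apply: IHs => [|e' s_e']; last first.
  by rewrite sD // inE s_e' orbT.
rewrite /greedy_step; case: ifP => // _.
by rewrite subUset sub1set sQD sD // mem_head.
Qed.

Lemma greedy_eft_spans_edge Q s e :
  1 <= k -> 0 <= weight G e -> e \in s -> eft_spans_edge G k f (greedy Q s) e.
Proof.
move=> k_ge1 w_ge0; elim: s Q => [|e' s IHs] Q //=.
rewrite inE => /predU1P[<-|]; last exact: IHs.
apply: eft_spans_edge_subset (subset_greedy _ s) _.
exact: greedy_step_eft_spans_edge.
Qed.

Lemma greedy_eft_spanner Q s :
  1 <= k -> Q \subset edges G -> s =i edges G :\: Q ->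
  eft_spanner G k f (greedy Q s).
Proof.
move=> k_ge1 sQG s_mem; apply: eft_spanner_spans_edge => [||e Ge].
- exact: lt_le_trans k_ge1.
- by apply: greedy_subset => // e; rewrite s_mem inE => /andP[].
have w_ge0 := weight_ge0 Ge; have [Qe|notQe] := boolP (e \in Q).
  exact: mem_eft_spans_edge (subsetP (subset_greedy Q s) e Qe).
by apply: greedy_eft_spans_edge; rewrite // s_mem inE notQe.
Qed.

End Greedy.

Theorem theorem3p5 (R : realType) (V : finType) (G : wgraph R V) (k : R)
    (f : nat) (H : {set {set V}}) (hk : 1 <= k) (hf : (0 < f)%N)
    (hH : light_ft_greedy_output G k f H) :
  eft_spanner G k f H.
Proof.
case: hH => Q [s [[[sQG _] _] /perm_mem s_mem _ ->]].
by apply: greedy_eft_spanner => // e; rewrite s_mem mem_enum.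
Qed.
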